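(* Let $I\subset\mathbb{R}$ be an interval and $V,\tilde V:I\to\mathbb{C}$ sufficiently smooth. Let $\tilde y=\alpha+i\tilde\beta$ (with $\alpha,\tilde\beta$ real-valued) be a solution on $I$ of the Riccati equation $\tilde y'=\tilde V-\tilde y^2$, and set $U=\operatorname{Re}V-\alpha^2-\alpha'=\operatorname{Re}(V-\tilde V)-\tilde\beta^2$. Assume that $U<0$ on $I$ (and that $\sqrt{|U|}+\tilde\beta$ has no zeros, so that $E_3$ below is well-defined). Let $g:I\to\mathbb{R}$ be a real-valued function and define $T$ by $$\log T(u)=\int^u E,\qquad E=|E_1+E_2+E_3|+E_4,$$ with the integration constant such that $T\ge1$, where $$E_1=\frac{1}{2|U|}\Big(4\alpha\operatorname{Re}(V-\tilde V)+\operatorname{Re}(V-\tilde V)'\Big),\qquad E_2=\frac{\tilde\beta}{|U|}\operatorname{Im}(V-\tilde V),$$ $$E_3=-\frac{\operatorname{Im}V}{|U|}\,\frac{\operatorname{Re}(V-\tilde V)}{\sqrt{|U|}+\tilde\beta},\qquad E_4=\frac{|\operatorname{Im}V|}{\sqrt{|U|}}\,g(u).$$ Assume that at every point of $I$, $$g\ge-\frac{T-1}{T}\ \text{ if }\operatorname{Im}V\ge0,\qquad g\ge T-1\ \text{ if }\operatorname{Im}V<0.$$ Define $$\beta=\frac{\sqrt{|U|}}{2}\Big(T+\frac1T\Big),\qquad R=\frac{\sqrt{|U|}}{2}\Big(T-\frac1T\Big).$$ Then the circle centered at $m(u)=\alpha(u)+i\beta(u)$ with radius $R(u)$ is invariant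 on $I$ under the Riccati flow $y'=V-y^2$.
   Context: The circles with center $m(u)\in\mathbb{C}$ and radius $R(u)\ge 0$ are called invariant on $I$ under the Riccati flow if for every complex-valued solution $y$ of $y'=V-y^2$ and all $u_0,u_1\in I$ with $u_1>u_0$, the inequality $|y(u_0)-m(u_0)|\le R(u_0)$ implies $|y(u_1)-m(u_1)|\le R(u_1)$. In applications $\tilde y=\tilde\phi'/\tilde\phi$ with $\tilde\phi$ a solution of $-\tilde\phi''+\tilde V\tilde\phi=0$. *)

(* Defs.v *)
From HB Require Import structures.
From mathcomp Require Import all_boot all_order all_algebra.
From mathcomp Require Import complex.
From mathcomp Require Import all_classical all_reals all_analysis.
Set Implicit Arguments.
Unset Strict Implicit.
Unset Printing Implicit Defensive.
Import Order.TTheory GRing.Theory Num.Theory.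
Import numFieldNormedType.Exports.

Local Open Scope classical_set_scope.
Local Open Scope ring_scope.
Local Open Scope complex_scope.

Section Calculus.
Context {R : realType}.
Implicit Types (I J : set R) (f L E : R -> R) (F V y m : R -> R[i]) (u : R).

(* All derivatives are taken within the interval I, so that they are
   one-sided at those end points of I that belong to I. *)
Definition dquot f u : R -> R := fun v => (f v - f u) / (v - u).

Definition derivable_in I f :=
  forall u, I u -> cvg (dquot f u v @[v --> within I u^']).

Definition deriv I f u : R := lim (dquot f u v @[v --> within I u^']).

Definition C1_in I f := derivable_in I f /\ {within I, continuous (deriv I f)}.

Definition cderivable_in I F :=
  derivable_in I (fun u => complex.Re (F u)) /\ derivable_in I (fun u => complex.Im (F u)).

Definition cderiv I F u : R[i] :=
  deriv I (fun u => complex.Re (F u)) u +i* deriv I (fun u => complex.Im (F u)) u.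

Definition cC1_in I F :=
  C1_in I (fun u => complex.Re (F u)) /\ C1_in I (fun u => complex.Im (F u)).

(* L is an indefinite (Lebesgue) integral of E on I; no regularity of E beyond
   integrability over the compact subintervals of I is required. *)
Definition indefinite_integral I L E :=
  forall a b, I a -> I b -> a <= b ->
    lebesgue_measure.-integrable `[a, b] (EFin \o E) /\
    L b - L a = \int[lebesgue_measure]_(u in `[a, b]) E u.

Definition riccati_solution J V y :=
  cderivable_in J y /\ forall u, J u -> cderiv J y u = V u - y u ^+ 2.

(* Solutions of the Riccati equation may blow up, so y ranges over the solutions
   on arbitrary subintervals J of I (in particular J = I is allowed). *)
Definition circles_invariant I V m (rad : R -> R) :=
  (forall u, I u -> 0 <= rad u) /\
  forall J y, is_interval J -> J `<=` I -> riccati_solution J V y ->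
  forall u0 u1, J u0 -> J u1 -> u0 < u1 ->
    `|y u0 - m u0| <= (rad u0)%:C -> `|y u1 - m u1| <= (rad u1)%:C.

End Calculus.

Section RiccatiData.
Context {R : realType} (I : set R) (V Vt yt : R -> R[i]).
Implicit Types (g T : R -> R) (u : R).

Definition alpha u : R := complex.Re (yt u).
Definition betat u : R := complex.Im (yt u).

Definition Upot u : R := complex.Re (V u) - alpha u ^+ 2 - deriv I alpha u.

Lemma UpotE u : riccati_solution I Vt yt -> I u ->
  Upot u = complex.Re (V u - Vt u) - betat u ^+ 2.
Proof.
move=> [_ /(_ u)] H Iu; move: (H Iu) => /(congr1 (@complex.Re _)) /=.
rewrite /Upot /alpha /betat => ->.
case: (V u) (Vt u) (yt u) => [a b] [c d] [e f] /=.
rewrite !expr2 /=.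
by rewrite !opprD !opprK !addrA [a - _ - _]addrAC subrK.
Qed.

Definition sqU u : R := Num.sqrt `|Upot u|.

Definition E1 u : R :=
  1 / (2 * `|Upot u|) *
  (4 * alpha u * complex.Re (V u - Vt u) + complex.Re (cderiv I (fun v => (V v - Vt v)%R) u)).

Definition E2 u : R := betat u / `|Upot u| * complex.Im (V u - Vt u).

Definition E3 u : R :=
  - (complex.Im (V u) / `|Upot u|) * (complex.Re (V u - Vt u) / (sqU u + betat u)).

Definition E4 g u : R := `|complex.Im (V u)| / sqU u * g u.

Definition Etot g u : R := `|E1 u + E2 u + E3 u| + E4 g u.

Definition circle_beta T u : R := sqU u / 2 * (T u + 1 / T u).
Definition circle_radius T u : R := sqU u / 2 * (T u - 1 / T u).
Definition circle_center T u : R[i] := alpha u +i* circle_beta T u.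

End RiccatiData.

(* Main.v *)
Require Import Defs.
From mathcomp Require Import all_boot all_order all_algebra.
From mathcomp Require Import complex.
From mathcomp Require Import all_classical all_reals all_analysis.
From mathcomp Require Import ring lra.
Import Order.TTheory GRing.Theory Num.Theory.
Import numFieldNormedType.Exports.
Local Open Scope classical_set_scope.
Local Open Scope ring_scope.
Local Open Scope complex_scope.

(** Translate by the real part of the given solution: with [x = Re y - alpha],
    [b = Im y], [s = sqrt |U|] and [W = Im V], the disc is
    [x^2 + b^2 + s^2 <= b s (T + 1/T)]. Since [s > 0] this forces [b > 0], and
    it says that [x + i b] lies within hyperbolic distance [log T] of [i s] in
    the upper half-plane. So the claim is that [log T] grows at least as fast
    as that distance when the point is on the circle.

    The rational functions of the statement collapse: differentiating
    [s^2 = betat^2 - Re (V - Vt)] and using the equation for [yt] gives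
    [s' = W - s (K + 2 alpha)] for [K = E1 + E2 + E3] (lemma [sqU_left_deriv]).
    With [q = (x^2 + b^2 + s^2) / (2 b s)], the hyperbolic cosine of the
    distance, one then finds
    [q' = K (q - s / b) + W (1/s + 1/b) (1 - q)], where
    [|q - s / b| <= sqrt (q^2 - 1)]. On the circle [1/T <= s/b <= T], and this
    bounds the rate of growth of the distance by
    [|K| + |W| g / s], precisely because of the two lower bounds imposed
    on [g] (lemmas [contact_rate_le] and [growth_ge_drift]).

    Passing from this infinitesimal bound to invariance needs care for three
    reasons. The inequality may be an equality on the circle, so the comparison
    is made with the slightly larger [T p] for
    [p = 1 + d exp (C (u - u1))]: a Gronwall argument, where [C] absorbs the
    Lipschitz dependence of the bound on [T] that appears when [W < 0], and [d]
    tends to 0 at the end (lemmas [barrier] and [disc_transport]). Next, [log T]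
    is only an indefinite Lebesgue integral, so [T] has no derivative at the
    point [c] of first contact; but its integrand is at least the continuous
    function [|K| + drift W T / s], whence [T v <= T c exp (m (v - c))] just to
    the left of [c], for every [m] smaller than the value of that function
    at [c]. Replacing [T] by this exponential gives a smooth function of
    nonpositive values that vanishes at [c], and its left derivative there has
    to be nonnegative, which contradicts the bound. Finally, derivatives are
    taken within the interval; only derivatives from the left at points that
    are not the left end are used, so the end points cause no trouble. *)

(** * Derivatives from the left *)

Section LeftDerivative.
Context {R : realType}.
Implicit Types (f g : R -> R) (I : set R) (u v l k : R).

Definition has_left_deriv f u l := dquot f u v @[v --> u^'-] --> l.

(** The filter is arbitrary, in order to serve for both the left derivative and
    the derivative within a set. *)
Lemma dquot_cvg_continuous {F : set_system R} {FF : Filter F} {f u l} :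
  F `=>` u^' -> dquot f u v @[v --> F] --> l -> f v @[v --> F] --> f u.
Proof.
move=> Fu fl.
have Fid : v @[v --> F] --> u.
  by apply: cvg_trans (Fu) _; exact: cvg_within.
have Fne : \forall v \near F, v != u.
  by apply: Fu; exact: withinT.
have e : f u + dquot f u v * (v - u) @[v --> F] --> f u + l * (u - u).
  by apply: cvgD; [exact: cvg_cst|apply: cvgM => //; apply: cvgB => //; exact: cvg_cst].
rewrite subrr mulr0 addr0 in e.
apply: cvg_trans e; apply: near_eq_cvg.
near=> v; have vu : v != u by near: v.
by rewrite /dquot divfK ?subr_eq0// addrC subrK.
Unshelve. all: by end_near. Qed.

Lemma at_left_dnbhs u : u^'- `=>` u^'.
Proof.
move=> A; rewrite /at_left /dnbhs /within /= => uA.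
by near=> v => vu; apply: (near uA v) => //; rewrite lt_eqF.
Unshelve. all: by end_near. Qed.

Lemma has_left_deriv_continuous {f u l} :
  has_left_deriv f u l -> f v @[v --> u^'-] --> f u.
Proof. by move=> fl; exact: (dquot_cvg_continuous (@at_left_dnbhs u) fl). Qed.

Lemma has_left_deriv_unique {f u l k} :
  has_left_deriv f u l -> has_left_deriv f u k -> l = k.
Proof. exact: cvg_unique. Qed.

Lemma has_left_deriv_eq f g u l :
  (\forall v \near u^'-, f v = g v) -> f u = g u ->
  has_left_deriv f u l -> has_left_deriv g u l.
Proof.
move=> fg fgu; apply: cvg_trans; apply: near_eq_cvg.
by near=> v; rewrite /dquot fgu (near fg v).
Unshelve. all: by end_near. Qed.

Lemma has_left_derivD {f g u l k} : has_left_deriv f u l ->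
  has_left_deriv g u k -> has_left_deriv (fun v => f v + g v) u (l + k).
Proof.
move=> fl gk; apply: cvg_trans (cvgD fl gk); apply: near_eq_cvg.
by near=> v; rewrite /dquot/= fctE; ring.
Unshelve. all: by end_near. Qed.

Lemma has_left_derivM {f g u l k} : has_left_deriv f u l ->
  has_left_deriv g u k ->
  has_left_deriv (fun v => f v * g v) u (l * g u + f u * k).
Proof.
move=> fl gk; have fu := has_left_deriv_continuous fl.
have h : dquot f u v * g u + f v * dquot g u v @[v --> u^'-] -->
    l * g u + f u * k.
  by apply: cvgD; apply: cvgM => //; exact: cvg_cst.
apply: cvg_trans h; apply: near_eq_cvg.
by near=> v; rewrite /dquot; ring.
Unshelve. all: by end_near. Qed.

Lemma has_left_deriv_cst a u : has_left_deriv (fun=> a) u 0.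
Proof.
have h : (0 : R) @[_ --> u^'-] --> (0 : R) by exact: cvg_cst.
apply: cvg_trans h; apply: near_eq_cvg.
by near=> v; rewrite /dquot/= subrr mul0r.
Unshelve. all: by end_near. Qed.

Lemma has_left_derivN {f u l} :
  has_left_deriv f u l -> has_left_deriv (fun v => - f v) u (- l).
Proof.
move=> fl; have := has_left_derivM (has_left_deriv_cst (-1) u) fl.
rewrite mul0r add0r mulN1r; apply: has_left_deriv_eq; last by rewrite mulN1r.
by near=> v; rewrite mulN1r.
Unshelve. all: by end_near. Qed.

Lemma has_left_deriv_id u : has_left_deriv id u 1.
Proof.
have h : (1 : R) @[_ --> u^'-] --> (1 : R) by exact: cvg_cst.
apply: cvg_trans h; apply: near_eq_cvg.
near=> v; rewrite /dquot/= divff// subr_eq0.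
by near: v; exact: nbhs_left_neq.
Unshelve. all: by end_near. Qed.

(** Caratheodory's form of differentiability avoids dividing by the increments
    of [f], which may vanish. *)
Lemma has_left_deriv_comp {f} {h : R -> R} {u l k} : has_left_deriv f u l ->
  is_derive (f u) 1 h k -> has_left_deriv (fun v => h (f v)) u (k * l).
Proof.
move=> fl /is_derive1_caratheodory[c [hc cc <-]].
have fu := has_left_deriv_continuous fl.
have h1 : c (f v) @[v --> u^'-] --> c (f u) by apply: continuous_cvg.
apply: cvg_trans (cvgM h1 fl); apply: near_eq_cvg.
by near=> v; rewrite /dquot/= hc mulrA.
Unshelve. all: by end_near. Qed.

Lemma has_left_derivV {f u l} : f u != 0 -> has_left_deriv f u l ->
  has_left_deriv (fun v => (f v)^-1) u (- l / f u ^+ 2).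
Proof.
move=> fu0 fl.
have iV : is_derive (f u) 1 (@GRing.inv R) (- (f u) ^- 2 *: 1).
  exact: (@is_deriveV R id (f u) 1 1 fu0 (is_derive_id _ _)).
have := has_left_deriv_comp fl iV.
by congr has_left_deriv; rewrite /GRing.scale/=; field.
Qed.

Lemma has_left_deriv_ge0 {f u l} :
  (\forall v \near u^'-, f v <= f u) -> has_left_deriv f u l -> 0 <= l.
Proof.
move=> fle fl; apply: (cvgr_to_ge fl); near=> v.
have vu : v < u by near: v; exact: nbhs_left_lt.
rewrite /dquot -mulrNN; apply: mulr_ge0.
  by rewrite oppr_ge0 subr_le0 (near fle v).
by rewrite oppr_ge0 invr_le0 subr_le0 ltW.
Unshelve. all: by end_near. Qed.

Lemma derivable_in_continuous {I f} : derivable_in I f ->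
  {within I, continuous f}.
Proof.
move=> fI; apply/subspace_continuousP => u Iu.
have fl : dquot f u v @[v --> within I u^'] --> Defs.deriv I f u := fI u Iu.
have FF : Filter (within I u^') by exact: within_filter.
have H : f v @[v --> within I u^'] --> f u.
  by apply: dquot_cvg_continuous fl; exact: cvg_within.
move=> A fA.
have uA : \forall v \near nbhs u, v != u -> I v -> A (f v).
  exact: (H A fA).
suff : \forall v \near nbhs u, I v -> A (f v) by [].
near=> v => Iv.
have [->|vu] := eqVneq v u; first exact: nbhs_singleton.
by apply: (near uA v).
Unshelve. all: by end_near. Qed.

Lemma at_left_within {I u0 u} : is_interval I -> I u0 -> I u -> u0 < u ->
  u^'- `=>` within I u^'.
Proof.
move=> itvI Iu0 Iu u0u A.
have H (B : set R) : (\forall v \near nbhs u, v != u -> I v -> B v) ->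
    \forall v \near nbhs u, v < u -> B v.
  move=> uB; near=> v => vu.
  apply: (near uB v) => //; first by rewrite lt_eqF.
  apply: (itvI _ _ Iu0 Iu); rewrite (ltW vu) andbT.
  by near: v; exact: lt_le_nbhsr.
exact: H.
Unshelve. all: by end_near. Qed.

Lemma near_left_in {I u0 u} : is_interval I -> I u0 -> I u -> u0 < u ->
  \forall v \near u^'-, I v.
Proof.
move=> itvI Iu0 Iu u0u; apply: (at_left_within itvI Iu0 Iu u0u).
exact: withinT.
Qed.

Lemma within_left_cvg {I f u0 u} : is_interval I -> I u0 -> I u -> u0 < u ->
  {within I, continuous f} -> f v @[v --> u^'-] --> f u.
Proof.
move=> itvI Iu0 Iu u0u /subspace_continuousP/(_ u Iu) fu.
apply: cvg_trans fu; apply: cvg_app.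
apply: cvg_trans (at_left_within itvI Iu0 Iu u0u) _ => A.
have H (B : set R) : (\forall v \near nbhs u, I v -> B v) ->
    \forall v \near nbhs u, v != u -> I v -> B v.
  by move=> uB; near=> v => _; exact: (near uB v).
exact: H.
Unshelve. all: by end_near. Qed.

Lemma derivable_in_left {I f u u0} : is_interval I -> I u0 -> I u -> u0 < u ->
  derivable_in I f -> has_left_deriv f u (Defs.deriv I f u).
Proof.
move=> itvI Iu0 Iu u0u fI.
have fl : dquot f u v @[v --> within I u^'] --> Defs.deriv I f u := fI u Iu.
apply: cvg_trans fl; apply: cvg_app.
exact: at_left_within itvI Iu0 Iu u0u.
Qed.

Lemma derivable_inB {I f g} : derivable_in I f -> derivable_in I g ->
  derivable_in I (fun v => f v - g v).
Proof.
move=> fI gI u Iu; apply: cvgP.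
have FF : Filter (within I u^') by exact: within_filter.
have fl : dquot f u v @[v --> within I u^'] --> Defs.deriv I f u := fI u Iu.
have gl : dquot g u v @[v --> within I u^'] --> Defs.deriv I g u := gI u Iu.
have h : dquot f u v - dquot g u v @[v --> within I u^'] -->
    Defs.deriv I f u - Defs.deriv I g u by exact: cvgB.
apply: cvg_trans h; apply: near_eq_cvg.
by near=> v; rewrite /dquot; ring.
Unshelve. all: by end_near. Qed.

(** As [deriv] is a limit, it can only be computed where this limit is unique;
    the point [u0] guarantees it. *)
Lemma deriv_inB {I f g u u0} : is_interval I -> I u0 -> I u -> u0 < u ->
  derivable_in I f -> derivable_in I g ->
  Defs.deriv I (fun v => f v - g v) u = Defs.deriv I f u - Defs.deriv I g u.
Proof.
move=> itvI Iu0 Iu u0u fI gI.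
have left h := @derivable_in_left I h u u0 itvI Iu0 Iu u0u.
apply: has_left_deriv_unique (left _ (derivable_inB fI gI)) _.
exact: has_left_derivD (left _ fI) (has_left_derivN (left _ gI)).
Qed.

End LeftDerivative.

(** * First contact *)

Section FirstContact.
Context {R : realType}.
Implicit Types (f : R -> R) (a b c u v : R).

Lemma first_zero {f a b} : a <= b -> {within `[a, b], continuous f} ->
  f a < 0 -> 0 <= f b ->
  exists c, [/\ a < c, c <= b, f c = 0 & forall v, a <= v -> v < c -> f v < 0].
Proof.
move=> ab /subspace_continuousP fab fa fb.
pose S := [set v | [/\ a <= v, v <= b & 0 <= f v]].
have Sb : S b by split.
have Slb : lbound S a by move=> v [].
have Slb' : has_lbound S by exists a.
have Sinf : has_inf S by split => //; exists b.
pose c := inf S.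
have ac : a <= c by apply: lb_le_inf => //; exists b.
have cb : c <= b by exact: ge_inf.
have fc v : a <= v -> v < c -> f v < 0.
  move=> av vc; rewrite ltNge; apply/negP => fv.
  have : c <= v by apply: ge_inf => //; split=> //; apply: (le_trans (ltW vc)).
  by rewrite leNgt vc.
have cab : `[a, b]%classic c by rewrite /= in_itv/= ac cb.
have fcc := fab _ cab.
have fc0 : 0 <= f c.
  rewrite leNgt; apply/negP => fc0.
  have : \forall v \near nbhs c, `[a, b]%classic v -> f v < 0.
    exact: (cvgr_lt _ fcc).
  case/nbhs_ballP => e /= e0 He.
  have [v [av vb fv] vce] := inf_adherent e0 Sinf.
  have cv : c <= v by exact: ge_inf.
  have : f v < 0.
    apply: He; last by rewrite /= in_itv/= av vb.
    by rewrite /ball/= ltr_distlC; apply/andP; split => //; lra.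
  by rewrite ltNge fv.
have ac' : a < c.
  rewrite lt_neqAle ac andbT; apply/negP => /eqP E.
  by move: fc0; rewrite -E leNgt fa.
exists c; split => //; apply/eqP; rewrite eq_le fc0 andbT leNgt; apply/negP => fcp.
have H : \forall v \near nbhs c, `[a, b]%classic v -> 0 < f v.
  exact: (cvgr_gt _ fcc).
have : \forall v \near c^'-, False.
  near=> v.
  have vc : v < c by near: v; exact: nbhs_left_lt.
  have av : a <= v by near: v; exact: nbhs_left_ge.
  have : 0 < f v.
    have Hv : `[a, b]%classic v -> 0 < f v.
      by near: v; exact: (cvg_within _ H).
    by apply: Hv; rewrite /= in_itv/= av (le_trans (ltW vc)).
  by rewrite ltNge ltW// fc.
by case/filter_ex.
Unshelve. all: by end_near. Qed.

End FirstContact.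

(** * The differential inequality at a point of the circle *)

Section Contact.
Context {R : realType}.
Implicit Types x b s al W K T p mu t : R.

(** The least value of [|W| g] allowed by the two lower bounds on [g], in a form
    that is visibly continuous in [W] and [T]. *)
Definition drift W T : R :=
  (`|W| - W) / 2 * (T - 1) - (`|W| + W) / 2 * ((T - 1) / T).

Lemma drift_pos W T : 0 <= W -> drift W T = - (W * ((T - 1) / T)).
Proof. by move=> W0; rewrite /drift ger0_norm//; set r := (T - 1) / T; field. Qed.

Lemma drift_neg W T : W < 0 -> drift W T = - W * (T - 1).
Proof. by move=> W0; rewrite /drift ltr0_norm//; set r := (T - 1) / T; field. Qed.

(** The hypothesis [0 <= ...] is the left derivative at the point of contact of
    [x^2 + b^2 + s^2 - b s (G + 1/G)], for a function [G] of value [t] and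
    logarithmic derivative [mu], after substitution of the equations for [x],
    [b] and [s]. On the circle it equals
    [2 (b + s) W (1 - k) + 2 s K (b k - s) - 2 b s sg mu] with
    [k = (t + 1/t) / 2] and [sg = (t - 1/t) / 2]. There
    [(b k - s)^2 = (b sg)^2 - x^2], so that the middle term is at most
    [2 s |K| b sg]; dividing by [2 b sg] and using [s / t <= b <= s t] gives the
    claim. The last term of the bound is the price for evaluating [drift] at [T]
    instead of [t], and vanishes with [p - 1]. *)
Lemma contact_rate_le x b s al W K T p mu (t := T * p) :
  0 < s -> 1 <= T -> 1 < p ->
  x ^+ 2 + b ^+ 2 + s ^+ 2 = b * s * (t + t^-1) ->
  0 <= 2 * x * (- s ^+ 2 - 2 * al * x - x ^+ 2 + b ^+ 2)
     + 2 * b * (W - 2 * (al + x) * b) + 2 * s * (W - s * (K + 2 * al))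
     - ((W - 2 * (al + x) * b) * s + b * (W - s * (K + 2 * al))) * (t + t^-1)
     - b * s * (mu * (t - t^-1)) ->
  s * mu <= s * `|K| + drift W T + `|W| * T * (p - 1).
Proof.
move=> s0 T1 p1 N0.
have t1 : 1 < t by rewrite /t; nra.
have tT : T <= t by rewrite /t; nra.
set i := t^-1 in N0 *.
have ti : t * i = 1 by rewrite mulfV// gt_eqF//; lra.
have i0 : 0 < i by rewrite invr_gt0; lra.
have i1 : i < 1 by nra.
have b0 : 0 < b.
  have : 0 < b * (s * (t + i)) by rewrite mulrA -N0; nra.
  by rewrite pmulr_lgt0//; nra.
(* Both bounds on b come from the sign of this product. *)
have P : (b - s * t) * (b - s * i) = - x ^+ 2.
  have -> : (b - s * t) * (b - s * i) = b ^+ 2 - b * s * (t + i) + s ^+ 2 * (t * i) by ring.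
  by rewrite ti -N0; ring.
have bst : b <= s * t.
  rewrite leNgt; apply/negP => h.
  have : b - s * i > 0 by nra.
  nra.
have sbt : s <= b * t.
  have sib : s * i <= b.
    rewrite leNgt; apply/negP => h.
    have : b - s * t < 0 by nra.
    nra.
  have -> : s = s * i * t by rewrite -mulrA [i * t]mulrC ti mulr1.
  by rewrite ler_pM2r//; lra.
have Q : `|b * (t + i) / 2 - s| <= b * (t - i) / 2.
  have bs0 : 0 <= b * (t - i) / 2 by nra.
  rewrite -[leRHS]ger0_norm// -ler_sqr ?nnegrE//.
  rewrite !real_normK ?num_real//.
  have -> : (b * (t + i) / 2 - s) ^+ 2 = (b * (t - i) / 2) ^+ 2 + b ^+ 2 * (t * i) - b * s * (t + i) + s ^+ 2.
    by field.
  rewrite ti -N0; nra.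
have KQ : K * (b * (t + i) / 2 - s) <= `|K| * (b * (t - i) / 2).
  by rewrite (le_trans (ler_norm _))// normrM ler_wpM2l.
(* The second line of the identity vanishes on the circle. *)
set e := (X in 0 <= X).
have -> : e = 2 * ((b + s) * W * (1 - (t + i) / 2) + s * (K * (b * (t + i) / 2 - s)) - b * s * ((t - i) / 2) * mu)
   - (2 * x + 4 * al) * (x ^+ 2 + b ^+ 2 + s ^+ 2 - b * s * (t + i)).
  by rewrite /e; field.
rewrite N0 subrr mulr0 subr0 => He.
have {}He : b * s * ((t - i) / 2) * mu <=
    (b + s) * W * (1 - (t + i) / 2) + s * (`|K| * (b * (t - i) / 2)).
  have := ler_wpM2l (ltW s0) KQ; lra.
have ti0 : 0 < t - i by lra.
have bti : 0 < b * ((t - i) / 2) by nra.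
have kE : 1 - (t + i) / 2 = - ((t - 1) * (1 - i) / 2).
  by have -> : (t - 1) * (1 - i) = t + i - 1 - t * i by [ring]; rewrite ti; field.
have sgE : (t - i) / 2 = (t - 1) * (1 + i) / 2.
  by have -> : (t - 1) * (1 + i) = t - i - 1 + t * i by [ring]; rewrite ti; field.
(* For W >= 0 this uses b / t <= s; for W < 0 it uses s <= b t. *)
have D : (b + s) * W * (1 - (t + i) / 2) <= (drift W T + `|W| * T * (p - 1)) * (b * ((t - i) / 2)).
  clear He KQ Q P N0.
  have [W0|W0] := leP 0 W.
    rewrite drift_pos// ger0_norm//.
    have bis : b * i <= s.
      by rewrite -(ler_pM2r (lt_trans ltr01 t1)) -mulrA [i * t]mulrC ti mulr1.
    have iT : i <= T^-1 by rewrite lef_pV2// posrE; lra.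
    have TE : (T - 1) / T = 1 - T^-1 by rewrite mulrBl mul1r divff//; lra.
    rewrite kE sgE TE.
    have h1 : b * (1 + i) * (1 - i) <= (b + s) * (1 - i) by rewrite ler_wpM2r//; lra.
    have h2 : b * (1 + i) * (1 - T^-1) <= b * (1 + i) * (1 - i) by rewrite ler_wpM2l//; nra.
    have h3 : 0 <= T * (p - 1) * (b * (1 + i)) by rewrite !mulr_ge0//; lra.
    have h4 : 0 <= W * (t - 1) / 2 by rewrite !mulr_ge0//; lra.
    have := ler_wpM2l h4 (_ : b * (1 + i) * (1 - T^-1) - T * (p - 1) * (b * (1 + i)) <= (b + s) * (1 - i)).
    by move=> /(_ ltac:(lra)); lra.
  rewrite drift_neg// ltr0_norm//.
  have h1 : (b + s) * (1 - i) <= b * (t - i).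
    have -> : b * (t - i) = (b + b * t) * (1 - i) + b * (t * i - 1) by ring.
    by rewrite ti subrr mulr0 addr0 ler_wpM2r//; lra.
  have -> : - W * (T - 1) + - W * T * (p - 1) = - W * (t - 1) by rewrite /t; ring.
  have h4 : 0 <= - W * (t - 1) / 2 by rewrite !mulr_ge0//; lra.
  have := ler_wpM2l h4 h1; rewrite kE; lra.
rewrite -(ler_pM2r bti); apply: le_trans (le_trans He _); last first.
  rewrite [leRHS]mulrDl.
  lra.
lra.
Qed.

End Contact.

(** * The barrier argument *)

Lemma addV_lt {R : realType} (t G : R) : 1 <= t -> t < G -> t + t^-1 < G + G^-1.
Proof.
move=> t1 tG; rewrite -subr_gt0.
have -> : G + G^-1 - (t + t^-1) = (G - t) * (1 - (t * G)^-1).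
  by field; apply/andP; split; lra.
by rewrite mulr_gt0 ?subr_gt0// invf_lt1; nra.
Qed.

Lemma addV_le {R : realType} (t G : R) : 1 <= t -> t <= G -> t + t^-1 <= G + G^-1.
Proof.
by move=> t1; rewrite le_eqVlt => /predU1P[->//|tG]; exact/ltW/addV_lt.
Qed.

Lemma has_left_deriv_expR {R : realType} (a c u : R) :
  has_left_deriv (fun v => expR (a * (v - c))) u (expR (a * (u - c)) * a).
Proof.
have dl : has_left_deriv (fun v => a * (v - c)) u a.
  have := has_left_derivM (has_left_deriv_cst a u)
    (has_left_derivD (has_left_deriv_id u) (has_left_deriv_cst (- c) u)).
  by rewrite mul0r add0r addr0 mulr1.
exact: (has_left_deriv_comp dl (is_derive_expR _)).
Qed.

Section Barrier.
Context {R : realType}.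
Variables (u0 u1 : R) (x b s al K W T : R -> R).
Hypothesis u01 : u0 < u1.
Local Notation J := (`[u0, u1]%classic : set R).
Hypotheses (xJ : {within J, continuous x}) (bJ : {within J, continuous b})
  (sJ : {within J, continuous s}) (WJ : {within J, continuous W})
  (TJ : {within J, continuous T}).
Hypothesis s_gt0 : forall u, J u -> 0 < s u.
Hypothesis T_ge1 : forall u, J u -> 1 <= T u.
Hypothesis K_left : forall u, u0 < u -> u <= u1 -> K v @[v --> u^'-] --> K u.
Hypothesis x_deriv : forall u, u0 < u -> u <= u1 -> has_left_deriv x u
  (- s u ^+ 2 - 2 * al u * x u - x u ^+ 2 + b u ^+ 2).
Hypothesis b_deriv : forall u, u0 < u -> u <= u1 -> has_left_deriv b u
  (W u - 2 * (al u + x u) * b u).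
Hypothesis s_deriv : forall u, u0 < u -> u <= u1 -> has_left_deriv s u
  (W u - s u * (K u + 2 * al u)).
Hypothesis T_growth : forall v u m, u0 < v -> v <= u -> u <= u1 ->
  (forall w, v <= w -> w <= u -> m <= `|K w| + drift (W w) (T w) / s w) ->
  m * (u - v) <= ln (T u) - ln (T v).

Let rate u := `|K u| + drift (W u) (T u) / s u.
Let N u := x u ^+ 2 + b u ^+ 2 + s u ^+ 2.

Let JP u : u0 < u -> u <= u1 -> J u.
Proof. by move=> u0u uu1; rewrite /= in_itv/= (ltW u0u). Qed.

Let Ju0 : J u0. Proof. by rewrite /= in_itv/= lexx ltW. Qed.

Let J_left_cvg (f : R -> R) c : {within J, continuous f} ->
  u0 < c -> c <= u1 -> f v @[v --> c^'-] --> f c.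
Proof.
move=> cf u0c cu1.
exact: within_left_cvg (@interval_is_interval _ _) Ju0 (JP _ u0c cu1) u0c cf.
Qed.

(** The error term in [contact_rate_le], once divided by [s], is thereby at most
    [M (p - 1)]. *)
Lemma drift_slope_bounded :
  exists M, 0 <= M /\ forall u, J u -> `|W u| * T u <= s u * M.
Proof.
have cM : {within J, continuous (fun u => `|W u| * T u / s u)}.
  apply/subspace_continuousP => u Ju.
  move: WJ TJ sJ => /subspace_continuousP/(_ u Ju) cW
    /subspace_continuousP/(_ u Ju) cT /subspace_continuousP/(_ u Ju) cs.
  apply: cvgM; first by apply: cvgM => //; exact: cvg_norm.
  by apply: cvgV => //; rewrite gt_eqF// s_gt0.
have [c cJ Hc] := EVT_max (ltW u01) cM.
exists (`|W c| * T c / s c); split.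
  have := T_ge1 _ cJ; have := s_gt0 _ cJ => sc Tc.
  by rewrite divr_ge0 ?mulr_ge0//; lra.
by move=> u Ju; rewrite -ler_pdivrMl ?s_gt0// mulrC Hc.
Qed.

Lemma rate_left_cvg c : u0 < c -> c <= u1 -> rate v @[v --> c^'-] --> rate c.
Proof.
move=> u0c cu1; have Jc := JP _ u0c cu1.
have cW := J_left_cvg _ _ WJ u0c cu1.
have cT := J_left_cvg _ _ TJ u0c cu1.
have cs := J_left_cvg _ _ sJ u0c cu1.
apply: cvgD; first by apply: cvg_norm; exact: K_left.
apply: cvgM; last by apply: cvgV; rewrite // gt_eqF// s_gt0.
have c1 : T v - 1 @[v --> c^'-] --> T c - 1.
  by apply: cvgB => //; exact: cvg_cst.
have nW : `|W v| @[v --> c^'-] --> `|W c| by exact: cvg_norm.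
apply: cvgB; apply: cvgM; try (apply: cvgM; last exact: cvg_cst).
- exact: cvgB.
- exact: c1.
- exact: cvgD.
- by apply: cvgM => //; apply: cvgV => //; have := T_ge1 _ Jc; lra.
Qed.

(** This one-sided bound replaces the derivative that [T] lacks. *)
Lemma T_le_expR c m : u0 < c -> c <= u1 -> m < rate c ->
  \forall v \near c^'-, T v <= T c * expR (m * (v - c)).
Proof.
move=> u0c cu1 mc.
have em : \forall v \near nbhs c, v < c -> m <= rate v.
  exact: (cvgr_ge _ (rate_left_cvg _ u0c cu1) _ mc).
case/nbhs_ballP : em => r /= r0 em.
near=> v.
have vc : v < c by near: v; exact: nbhs_left_lt.
have vr : c - r < v by near: v; apply: nbhs_left_gt; rewrite ltrBlDr ltrDl.
have u0v : u0 < v by near: v; exact: nbhs_left_gt.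
have T_gt0 w : u0 < w -> w <= u1 -> 0 < T w.
  by move=> u0w wu1; exact: lt_le_trans ltr01 (T_ge1 _ (JP _ u0w wu1)).
have h : m * (c - v) <= ln (T c) - ln (T v).
  apply: T_growth (ltW vc) cu1 _ => // w vw.
  rewrite le_eqVlt => /predU1P[->|wc]; first exact: ltW.
  apply: em => //; rewrite /ball/= ltr_distlC (lt_le_trans vr vw).
  by rewrite (lt_trans wc)// ltrDl.
have vu1 : v <= u1 := le_trans (ltW vc) cu1.
rewrite -[leLHS]lnK ?posrE ?T_gt0// -[X in X * _]lnK ?posrE ?T_gt0//.
by rewrite -expRD ler_expR -lerBlDl -[m * _]opprK -mulrN opprB lerNr opprB.
Unshelve. all: by end_near. Qed.

(** Suppose the disc of parameter [t = T p] is left, and let [c] be the first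
    point where its circle is met. Contact from the inside bounds the rate
    [m + p'/p] of the barrier at [c] by [rate c + M (p - 1)], while
    [m + p'/p >= rate c - (p - 1) / 2 + (M + 1) (p - 1)] by the choice of [m]
    and [C]. *)
Lemma barrier (d : R) : 0 < d -> d <= 1 ->
  N u0 <= b u0 * s u0 * (T u0 + (T u0)^-1) ->
  N u1 < b u1 * s u1 * (T u1 * (1 + d) + (T u1 * (1 + d))^-1).
Proof.
move=> d0 d1 N0.
have [M [M0 HM]] := drift_slope_bounded.
(* The factor 2 pays for replacing (p - 1) / p by p - 1, as p <= 2; the extra 1
   makes the barrier strict. *)
pose C := 2 * (M + 1).
pose p v := 1 + d * expR (C * (v - u1)).
have p_gt1 v : 1 < p v by rewrite ltrDl mulr_gt0// expR_gt0.
have p_le2 v : v <= u1 -> p v <= 2.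
  move=> vu1; have : expR (C * (v - u1)) <= 1.
    by rewrite -expR0 ler_expR; rewrite /C; nra.
  have := expR_gt0 (C * (v - u1)); rewrite /p; nra.
have pu1 : p u1 = 1 + d by rewrite /p subrr mulr0 expR0 mulr1.
pose t v := T v * p v.
have T_lt_t v : J v -> T v < t v.
  move=> Jv; rewrite /t ltr_pMr ?p_gt1//.
  exact: lt_le_trans ltr01 (T_ge1 _ Jv).
have t_ge1 v : J v -> 1 <= t v.
  by move=> Jv; exact: le_trans (T_ge1 _ Jv) (ltW (T_lt_t _ Jv)).
pose f v := N v - b v * s v * (t v + (t v)^-1).
have cf : {within J, continuous f}.
  apply/subspace_continuousP => u Ju.
  move: xJ bJ TJ sJ => /subspace_continuousP/(_ u Ju) cx
    /subspace_continuousP/(_ u Ju) cb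
    /subspace_continuousP/(_ u Ju) cT /subspace_continuousP/(_ u Ju) cs.
  have ct : t v @[v --> within J (nbhs u)] --> t u.
    apply: cvgM => //; apply: cvgD; first exact: cvg_cst.
    apply: cvgM; first exact: cvg_cst.
    apply: continuous_cvg; first exact: continuous_expR.
    apply: cvgM; first exact: cvg_cst.
    apply: cvgB; last exact: cvg_cst.
    by move=> A; exact: cvg_within.
  apply: cvgB.
    have sq (h : R -> R) : h v @[v --> within J (nbhs u)] --> h u ->
        h v ^+ 2 @[v --> within J (nbhs u)] --> h u ^+ 2.
      by move=> hu; exact: (cvgM hu hu).
    by apply: cvgD; [apply: cvgD|]; exact: sq.
  apply: cvgM; first exact: cvgM.
  by apply: cvgD => //; apply: cvgV => //; have := t_ge1 _ Ju; lra.
(* The discs lie in the upper half-plane, since N > 0. *)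
have b_gt0 v k : J v -> 0 < k -> N v <= b v * s v * (k + k^-1) -> 0 < b v.
  move=> Jv k0 Nv; have sv := s_gt0 _ Jv.
  have sk : 0 < s v * (k + k^-1) by rewrite mulr_gt0// addr_gt0// invr_gt0.
  rewrite -(pmulr_lgt0 _ sk) mulrA; apply: lt_le_trans Nv.
  by rewrite ltr_wpDl ?addr_ge0 ?sqr_ge0// exprn_gt0.
have f0 : f u0 < 0.
  have T0 := T_ge1 _ Ju0.
  have b0 := b_gt0 _ _ Ju0 (lt_le_trans ltr01 T0) N0.
  rewrite /f subr_lt0 (le_lt_trans N0)// ltr_pM2l ?mulr_gt0 ?s_gt0//.
  exact: addV_lt (T_lt_t _ Ju0).
rewrite -pu1 -subr_lt0 -/(t u1) -/(f u1) ltNge; apply/negP => f1.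
have [c [u0c cu1 fc fneg]] := first_zero (ltW u01) cf f0 f1.
have Jc := JP _ u0c cu1.
have s0 := s_gt0 _ Jc.
have T1 := T_ge1 _ Jc.
have p1 := p_gt1 c.
have p0 : p c != 0 by rewrite gt_eqF// (lt_trans ltr01).
have t0 : t c != 0 by rewrite gt_eqF// (lt_le_trans ltr01) ?t_ge1.
have Nc : N c = b c * s c * (t c + (t c)^-1).
  by apply/eqP; rewrite -subr_eq0; apply/eqP.
have b0 : 0 < b c.
  by apply: (b_gt0 _ (t c)); rewrite ?Nc// (lt_le_trans ltr01) ?t_ge1.
(* T is only absolutely continuous, so the barrier is first enlarged on the left
   of c to the smooth G, which still touches it at c. *)
pose m := rate c - (p c - 1) / 2.
have mc : m < rate c by rewrite ltrBlDr ltrDl divr_gt0// subr_gt0.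
pose G v := T c * expR (m * (v - c)) * p v.
pose H v := x v * x v + b v * b v + s v * s v - b v * s v * (G v + (G v)^-1).
have Gc : G c = t c by rewrite /G subrr mulr0 expR0 mulr1.
have Hc : H c = 0 by rewrite -fc /H /f /N Gc !expr2.
have Hle : \forall v \near c^'-, H v <= H c.
  near=> v.
  have vc : v < c by near: v; exact: nbhs_left_lt.
  have u0v : u0 < v by near: v; exact: nbhs_left_gt.
  have Jv := JP _ u0v (le_trans (ltW vc) cu1).
  have bv : 0 < b v.
    by near: v; apply: (cvgr_gt (b c)) => //; exact: J_left_cvg.
  have tG : t v <= G v.
    rewrite ler_pM2r ?(lt_trans ltr01)//.
    by near: v; exact: T_le_expR.
  rewrite Hc; apply/ltW/(le_lt_trans _ (fneg v (ltW u0v) vc)).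
  rewrite /H /f /N !expr2 lerD2l lerN2 ler_wpM2l ?addV_le ?t_ge1//.
  by rewrite mulr_ge0// ltW// s_gt0.
have dp : has_left_deriv p c (C * (p c - 1)).
  have := has_left_derivD (has_left_deriv_cst 1 c)
    (has_left_derivM (has_left_deriv_cst d c) (has_left_deriv_expR C u1 c)).
  by rewrite mul0r !add0r /p addrAC subrr add0r mulrA mulrC.
pose mu := m + C * (p c - 1) / p c.
have dG : has_left_deriv G c (t c * mu).
  have := has_left_derivM
    (has_left_derivM (has_left_deriv_cst (T c) c) (has_left_deriv_expR m c c)) dp.
  rewrite subrr mulr0 expR0 !mul0r !add0r mulr1 mul1r.
  by congr has_left_deriv; rewrite /t /mu; field.
have dVG : has_left_deriv (fun v => (G v)^-1) c (- (mu / t c)).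
  have Gc0 : G c != 0 by rewrite Gc.
  have := has_left_derivV Gc0 dG.
  by congr has_left_deriv; rewrite Gc; field.
have dx := x_deriv _ u0c cu1.
have db := b_deriv _ u0c cu1.
have ds := s_deriv _ u0c cu1.
have dH := has_left_derivD
  (has_left_derivD (has_left_derivD (has_left_derivM dx dx)
     (has_left_derivM db db)) (has_left_derivM ds ds))
  (has_left_derivN (has_left_derivM (has_left_derivM db ds)
     (has_left_derivD dG dVG))).
have H0 := has_left_deriv_ge0 Hle dH.
have : s c * mu <= s c * `|K c| + drift (W c) (T c) + `|W c| * T c * (p c - 1).
  apply: (@contact_rate_le _ (x c) (b c) (s c) (al c)) => //.
  by move: H0; rewrite Gc; congr (0 <= _); rewrite -/(t c); field.
apply/negP; rewrite -ltNge.
have pos : 0 < p c - 1 by rewrite subr_gt0.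
apply: (@le_lt_trans _ _ (s c * (rate c + M * (p c - 1)))).
  have -> : s c * (rate c + M * (p c - 1)) =
      s c * `|K c| + drift (W c) (T c) + s c * M * (p c - 1).
    by rewrite /rate; field; rewrite gt_eqF.
  by rewrite lerD2l ler_wpM2r ?HM// ltW.
rewrite ltr_pM2l// /mu /m -[ltRHS]addrA ltrD2l.
apply: (@lt_le_trans _ _ (- ((p c - 1) / 2) + (M + 1) * (p c - 1))).
  by rewrite -subr_gt0; set q := p c - 1 in pos *; lra.
rewrite lerD2l ler_pdivlMr ?(lt_trans ltr01)// /C.
have h : 0 <= (M + 1) * (p c - 1) * (2 - p c).
  apply: mulr_ge0; last by rewrite subr_ge0 p_le2.
  by rewrite mulr_ge0 ?(ltW pos)// addr_ge0.
by rewrite -subr_ge0; move: h; congr (0 <= _); ring.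
Unshelve. all: by end_near. Qed.

Lemma disc_transport :
  N u0 <= b u0 * s u0 * (T u0 + (T u0)^-1) ->
  N u1 <= b u1 * s u1 * (T u1 + (T u1)^-1).
Proof.
move=> N0.
have Ju1 : J u1 := JP _ u01 (lexx _).
have T1 := T_ge1 _ Ju1.
have s0 := s_gt0 _ Ju1.
have H : b u1 * s u1 * (T u1 * (1 + d) + (T u1 * (1 + d))^-1) @[d --> 0^'+] -->
    b u1 * s u1 * (T u1 * (1 + 0) + (T u1 * (1 + 0))^-1).
  have c1 : T u1 * (1 + d) @[d --> 0^'+] --> T u1 * (1 + 0).
    apply: cvgM; first exact: cvg_cst.
    apply: cvgD; first exact: cvg_cst.
    by move=> A; exact: cvg_within.
  apply: cvgM; first exact: cvg_cst.
  by apply: cvgD => //; apply: cvgV => //; lra.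
rewrite addr0 mulr1 in H.
apply: (cvgr_to_ge H); near=> d.
apply/ltW/barrier => //.
by near: d; exact: nbhs_right_le.
Unshelve. all: by end_near. Qed.

End Barrier.

(** * The data of the Riccati equation *)

Definition E123 {R : realType} (I : set R) (V Vt yt : R -> R[i]) (u : R) : R :=
  E1 I V Vt yt u + E2 I V Vt yt u + E3 I V Vt yt u.

Section RiccatiFrame.
Context {R : realType}.
Context {I : set R} {V Vt yt : R -> R[i]}.
Hypotheses (I_interval : is_interval I)
  (V_C1 : cC1_in I V) (Vt_C1 : cC1_in I Vt)
  (yt_sol : riccati_solution I Vt yt)
  (U_lt0 : forall u, I u -> Upot I V yt u < 0)
  (E3_def : forall u, I u -> sqU I V yt u + betat yt u != 0).

Local Notation s := (sqU I V yt).
Local Notation al := (alpha yt).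
Local Notation be := (betat yt).
Local Notation K := (E123 I V Vt yt).
Local Notation D := (fun v => complex.Re (V v) - complex.Re (Vt v)).

Lemma ReB (z w : R[i]) : complex.Re (z - w) = complex.Re z - complex.Re w.
Proof. by case: z w => [? ?] [? ?]. Qed.

Lemma ImB (z w : R[i]) : complex.Im (z - w) = complex.Im z - complex.Im w.
Proof. by case: z w => [? ?] [? ?]. Qed.

Lemma ReX2 (z : R[i]) : complex.Re (z ^+ 2) = complex.Re z ^+ 2 - complex.Im z ^+ 2.
Proof. by case: z => a b; rewrite !expr2. Qed.

Lemma ImX2 (z : R[i]) : complex.Im (z ^+ 2) = 2 * complex.Re z * complex.Im z.
Proof. by case: z => a b; rewrite !expr2 /=; ring. Qed.

Lemma sqU_gt0 {u} : I u -> 0 < s u.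
Proof. by move=> Iu; rewrite sqrtr_gt0 normr_gt0 lt_eqF// U_lt0. Qed.

Lemma normU {u} : I u -> `|Upot I V yt u| = be u ^+ 2 - D u.
Proof.
by move=> Iu; rewrite ltr0_norm ?U_lt0// (UpotE V yt_sol Iu) ReB opprB.
Qed.

Lemma sqU_sqr u : s u ^+ 2 = `|Upot I V yt u|.
Proof. by rewrite sqr_sqrtr. Qed.

Let reV_deriv : derivable_in I (fun u => complex.Re (V u)) := V_C1.1.1.
Let reVt_deriv : derivable_in I (fun u => complex.Re (Vt u)) := Vt_C1.1.1.
Let al_deriv : derivable_in I al := yt_sol.1.1.
Let be_deriv : derivable_in I be := yt_sol.1.2.

Lemma sqU_continuous : {within I, continuous s}.
Proof.
have h : {within I, continuous (fun v => Num.sqrt (be v ^+ 2 - D v))}.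
  apply/subspace_continuousP => u Iu.
  move/derivable_in_continuous/subspace_continuousP: reV_deriv => /(_ u Iu) c1.
  move/derivable_in_continuous/subspace_continuousP: reVt_deriv => /(_ u Iu) c2.
  move/derivable_in_continuous/subspace_continuousP: be_deriv => /(_ u Iu) c3.
  apply: continuous_cvg; first exact: sqrt_continuous.
  by apply: cvgB; [exact: (cvgM c3 c3)|exact: cvgB].
apply: subspace_eq_continuous h => v /set_mem Iv.
by rewrite /from_subspace /sqU normU.
Qed.

Section AtPoint.
Context {u0 u : R}.
Hypotheses (Iu0 : I u0) (Iu : I u) (u0u : u0 < u).

(** This identity is what [E1], [E2] and [E3] are made for: as
    [Re (V - Vt) = betat^2 - s^2] is divisible by [s + betat], the three terms
    add up to [- s' / s - 2 alpha + Im V / s]. *)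
Lemma sqU_left_deriv :
  has_left_deriv s u (complex.Im (V u) - s u * (K u + 2 * al u)).
Proof.
have left h := @derivable_in_left R I h u u0 I_interval Iu0 Iu u0u.
have dbe : Defs.deriv I be u = complex.Im (Vt u) - 2 * al u * be u.
  have := congr1 (@complex.Im R) (yt_sol.2 u Iu).
  by rewrite ImB ImX2.
have lD := has_left_derivD (left _ reV_deriv) (has_left_derivN (left _ reVt_deriv)).
have lb := left _ be_deriv.
have lU := has_left_derivD (has_left_derivM lb lb) (has_left_derivN lD).
have s0 := sqU_gt0 Iu.
have sE := sqU_sqr u; rewrite normU// in sE.
have U0 : 0 < be u * be u - D u by rewrite -expr2 -sE exprn_gt0.
have := has_left_deriv_comp lU (is_derive1_sqrt U0).
have -> : Num.sqrt (be u * be u - D u) = s u by rewrite /sqU normU// expr2.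
move=> ls.
have {}ls : has_left_deriv s u ((2 * s u)^-1 *
   ((Defs.deriv I be u * be u + be u * Defs.deriv I be u) -
   (Defs.deriv I (fun u => complex.Re (V u)) u - Defs.deriv I (fun u => complex.Re (Vt u)) u))).
  apply: has_left_deriv_eq ls; last by rewrite /sqU normU// expr2.
  near=> v.
  have Iv : I v by near: v; exact: near_left_in I_interval Iu0 Iu u0u.
  by rewrite /sqU normU// expr2.
move: ls; congr has_left_deriv.
rewrite /E123 /E1 /E2 /E3 ReB ImB /= (funext (fun v => ReB (V v) (Vt v))).
rewrite (deriv_inB I_interval Iu0 Iu u0u reV_deriv reVt_deriv) dbe.
rewrite normU// -sE.
have := E3_def _ Iu.
have -> : complex.Re (V u) - complex.Re (Vt u) = be u ^+ 2 - s u ^+ 2 by rewrite sE; ring.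
move=> sb; field.
by rewrite sb gt_eqF.
Unshelve. all: by end_near. Qed.

Lemma E123_left_cvg : K v @[v --> u^'-] --> K u.
Proof.
have cont h := @within_left_cvg R I h u0 u I_interval Iu0 Iu u0u.
have cD' : Defs.deriv I D v @[v --> u^'-] --> Defs.deriv I D u.
  rewrite (deriv_inB I_interval Iu0 Iu u0u reV_deriv reVt_deriv).
  apply: cvg_trans (cvgB (cont _ V_C1.1.2) (cont _ Vt_C1.1.2)).
  apply: near_eq_cvg; near=> v.
  have Iv : I v by near: v; exact: near_left_in I_interval Iu0 Iu u0u.
  have u0v : u0 < v by near: v; exact: nbhs_left_gt.
  by rewrite (deriv_inB I_interval Iu0 Iv u0v reV_deriv reVt_deriv).
have cre := cont _ (derivable_in_continuous reV_deriv).
have cret := cont _ (derivable_in_continuous reVt_deriv).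
have cim := cont _ (derivable_in_continuous V_C1.2.1).
have cimt := cont _ (derivable_in_continuous Vt_C1.2.1).
have cal := cont _ (derivable_in_continuous al_deriv).
have cbe := cont _ (derivable_in_continuous be_deriv).
have cs := cont _ sqU_continuous.
have cS : s v ^+ 2 @[v --> u^'-] --> s u ^+ 2 by exact: (cvgM cs cs).
have s0 := sqU_gt0 Iu.
have S0 : s u ^+ 2 != 0 by rewrite expf_neq0// gt_eqF.
have EE : K = fun v =>
    1 / (2 * s v ^+ 2) * (4 * al v * D v + Defs.deriv I D v) +
    be v / s v ^+ 2 * (complex.Im (V v) - complex.Im (Vt v)) +
    - (complex.Im (V v) / s v ^+ 2) * (D v / (s v + be v)).
  apply/funext => v.
  rewrite /E123 /E1 /E2 /E3 ReB ImB /= (funext (fun v => ReB (V v) (Vt v))).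
  by rewrite sqU_sqr.
rewrite EE.
have cD : D v @[v --> u^'-] --> D u by exact: cvgB.
apply: cvgD; first apply: cvgD; apply: cvgM.
- apply: cvgM; first exact: cvg_cst.
  apply: cvgV; first by rewrite mulf_neq0.
  by apply: cvgM => //; exact: cvg_cst.
- apply: cvgD => //; apply: cvgM => //; apply: cvgM => //; exact: cvg_cst.
- by apply: cvgM => //; exact: cvgV.
- exact: cvgB.
- by apply: cvgN; apply: cvgM => //; exact: cvgV.
- apply: cvgM => //; apply: cvgV; first exact: E3_def.
  exact: cvgD.
Unshelve. all: by end_near. Qed.

End AtPoint.
End RiccatiFrame.

Lemma growth_ge_drift {R : realType} {I : set R} {V Vt yt : R -> R[i]}
    {g T : R -> R} {u} :
  0 < sqU I V yt u ->
  (0 <= complex.Im (V u) -> g u >= - ((T u - 1) / T u)) ->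
  (complex.Im (V u) < 0 -> g u >= T u - 1) ->
  `|E123 I V Vt yt u| + drift (complex.Im (V u)) (T u) / sqU I V yt u
    <= Etot I V Vt yt g u.
Proof.
move=> s0 gp gn; rewrite /Etot lerD2l /E4 mulrAC ler_pM2r ?invr_gt0//.
have [W0|W0] := leP 0 (complex.Im (V u)).
  by rewrite drift_pos// ger0_norm// -mulrN ler_wpM2l// gp.
by rewrite drift_neg// ltr0_norm// ler_wpM2l ?gn// oppr_ge0 ltW.
Qed.

(** * From the integral equation for T to invariance *)

Lemma indefinite_integral_ge {R : realType} {I : set R} {L E : R -> R} {a b m} :
  indefinite_integral I L E -> I a -> I b -> a <= b ->
  (forall w, a <= w -> w <= b -> m <= E w) -> m * (b - a) <= L b - L a.
Proof.
move=> /(_ a b)H Ia Ib ab mE; have [iE ->] := H Ia Ib ab.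
have -> : m * (b - a) = \int[lebesgue_measure]_(u in `[a, b]) m.
  rewrite Rintegral_cst//= lebesgue_measure_itv/= lte_fin.
  case: ifPn => [//|]; rewrite -leNgt => ba.
  by have -> : b = a by [apply/le_anti; rewrite ab ba]; rewrite subrr !mulr0.
apply: le_Rintegral => //.
- apply: continuous_compact_integrable; first exact: segment_compact.
  by apply: continuous_subspaceT => ?; exact: cvg_cst.
- by move=> w; rewrite /= in_itv/= => /andP[]; exact: mE.
Qed.

Lemma indefinite_integral_continuous {R : realType} {I : set R} {L E : R -> R} {a b} :
  indefinite_integral I L E -> is_interval I -> I a -> I b -> a <= b ->
  {within `[a, b], continuous L}.
Proof.
move=> H itvI Ia Ib ab.
have [iE _] := H _ _ Ia Ib ab.
have := parameterized_integral_continuous ab iE.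
move=> /subspace_continuousP c; apply/subspace_continuousP => u Ju.
have LE v : `[a, b]%classic v -> parameterized_integral lebesgue_measure a v E + L a = L v.
  rewrite /= in_itv/= => /andP[av vb].
  have Iv : I v by apply: (itvI _ _ Ia Ib); rewrite av.
  by have [_] := H _ _ Ia Iv av; rewrite /parameterized_integral => <-; rewrite subrK.
have h : parameterized_integral lebesgue_measure a v E + L a
    @[v --> within `[a, b] (nbhs u)] -->
    parameterized_integral lebesgue_measure a u E + L a.
  by apply: cvgD; [exact: c|exact: cvg_cst].
rewrite LE// in h; apply: cvg_trans h; apply: near_eq_cvg.
by apply: filterS (withinT _ _) => v; exact: LE.
Qed.

Lemma normc_leP {R : realType} (z : R[i]) (r : R) : 0 <= r ->
  (`|z| <= r%:C) = (complex.Re z ^+ 2 + complex.Im z ^+ 2 <= r ^+ 2).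
Proof.
move=> r0; rewrite normc_def lecR -[r in LHS]ger0_norm// -sqrtr_sqr ler_sqrt//.
exact: sqr_ge0.
Qed.

(** The equation of the circle simplifies because [beta^2 - R^2 = s^2]. *)
Lemma mem_circleE {R : realType} (I : set R) (V yt : R -> R[i]) (T : R -> R)
    (z : R[i]) u (x := complex.Re z - alpha yt u) (b := complex.Im z)
    (s := sqU I V yt u) :
  1 <= T u ->
  (`|z - circle_center I V yt T u| <= (circle_radius I V yt T u)%:C) =
  (x ^+ 2 + b ^+ 2 + s ^+ 2 <= b * s * (T u + (T u)^-1)).
Proof.
move=> T1; have s0 : 0 <= s by exact: sqrtr_ge0.
have i1 : (T u)^-1 <= 1 by rewrite invf_le1//; lra.
rewrite normc_leP; last first.
  by rewrite /circle_radius -/s div1r mulr_ge0//; lra.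
rewrite ReB ImB /circle_center/= -/x -/b /circle_beta /circle_radius -/s !div1r.
rewrite -subr_ge0 -[RHS]subr_ge0; congr (0 <= _).
by field; lra.
Qed.

Theorem theorem3p3 (R : realType) (I : set R) (V Vt yt : R -> R[i])
    (g T : R -> R)
    (I_interval : is_interval I)
    (V_C1 : cC1_in I V) (Vt_C1 : cC1_in I Vt)
    (yt_sol : riccati_solution I Vt yt)
    (U_lt0 : forall u, I u -> Upot I V yt u < 0)
    (E3_def : forall u, I u -> sqU I V yt u + betat yt u != 0)
    (T_ge1 : forall u, I u -> 1 <= T u)
    (logT : indefinite_integral I (fun u => ln (T u)) (Etot I V Vt yt g))
    (g_pos : forall u, I u -> 0 <= complex.Im (V u) -> g u >= - ((T u - 1) / T u))
    (g_neg : forall u, I u -> complex.Im (V u) < 0 -> g u >= T u - 1) :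
  circles_invariant I V (circle_center I V yt T) (circle_radius I V yt T).
Proof.
split=> [u Iu|J y itvJ JI [[rey imy] yE] u0 u1 Ju0 Ju1 u01].
  have T1 := T_ge1 _ Iu.
  have i1 : (T u)^-1 <= 1 by rewrite invf_le1//; lra.
  by rewrite /circle_radius div1r mulr_ge0 ?divr_ge0 ?sqrtr_ge0//; lra.
have Iu0 := JI _ Ju0; have Iu1 := JI _ Ju1.
rewrite !mem_circleE ?T_ge1//.
have JJ u : `[u0, u1]%classic u -> J u.
  by rewrite /= in_itv/= => uu; exact: (itvJ _ _ Ju0 Ju1).
have JI' u : `[u0, u1]%classic u -> I u by move=> /JJ/JI.
have JJ' u : u0 < u -> u <= u1 -> J u by move=> *; apply: JJ; rewrite /= in_itv/= ltW.
have restr (A : set R) (f : R -> R) : `[u0, u1]%classic `<=` A ->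
    {within A, continuous f} -> {within `[u0, u1], continuous f}.
  by move=> sub cA; exact: (continuous_subspaceW sub cA).
have alI : derivable_in I (alpha yt) := yt_sol.1.1.
pose x u := complex.Re (y u) - alpha yt u.
pose b u := complex.Im (y u).
have cx : {within `[u0, u1], continuous x}.
  have c1 := restr _ _ JJ (derivable_in_continuous rey).
  have c2 := restr _ _ JI' (derivable_in_continuous alI).
  apply/subspace_continuousP => u uJ.
  move/subspace_continuousP/(_ u uJ) : c1 => c1.
  move/subspace_continuousP/(_ u uJ) : c2 => c2.
  exact: cvgB.
have cT : {within `[u0, u1], continuous T}.
  have c := indefinite_integral_continuous logT I_interval Iu0 Iu1 (ltW u01).
  have h : {within `[u0, u1], continuous (fun u => expR (ln (T u)))}.
    apply/subspace_continuousP => u uJ.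
    move/subspace_continuousP/(_ u uJ) : c => c.
    by apply: continuous_cvg => //; exact: continuous_expR.
  apply: subspace_eq_continuous h => v /set_mem /JI' Iv.
  by rewrite /from_subspace lnK// posrE (lt_le_trans _ (T_ge1 _ Iv)).
apply: (@disc_transport R u0 u1 x b (sqU I V yt) (alpha yt)
  (E123 I V Vt yt) (fun u => complex.Im (V u)) T) => //.
- exact: (restr _ _ JJ (derivable_in_continuous imy)).
- exact: (restr _ _ JI' (sqU_continuous V_C1 Vt_C1 yt_sol U_lt0)).
- exact: (restr _ _ JI' (derivable_in_continuous V_C1.2.1)).
- by move=> u /JI'; exact: sqU_gt0.
- by move=> u /JI'; exact: T_ge1.
- move=> u u0u uu1; apply: (E123_left_cvg I_interval V_C1 Vt_C1 yt_sol U_lt0 E3_def Iu0) => //.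
  exact/JI/JJ'.
- move=> u u0u uu1; have uJ := JJ' _ u0u uu1; have Iu := JI _ uJ.
  have := has_left_derivD (derivable_in_left itvJ Ju0 uJ u0u rey)
    (has_left_derivN (derivable_in_left I_interval Iu0 Iu u0u alI)).
  congr has_left_deriv.
  have /(congr1 (@complex.Re R)) /= -> := yE _ uJ.
  have /(congr1 (@complex.Re R)) := yt_sol.2 _ Iu; rewrite /cderiv/= => ->.
  rewrite sqU_sqr (normU yt_sol U_lt0)// !ReB !ReX2.
  rewrite /x /b /alpha /betat; ring.
- move=> u u0u uu1; have uJ := JJ' _ u0u uu1.
  have := derivable_in_left itvJ Ju0 uJ u0u imy.
  congr has_left_deriv.
  have /(congr1 (@complex.Im R)) /= -> := yE _ uJ.
  by rewrite ImB ImX2 /x /b; ring.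
- move=> u u0u uu1; apply: (sqU_left_deriv I_interval V_C1 Vt_C1 yt_sol U_lt0 E3_def Iu0) => //.
  exact/JI/JJ'.
- move=> v u m u0v vu uu1 Hm.
  apply: (indefinite_integral_ge logT) => //.
  + by apply/JI/JJ' => //; exact: le_trans uu1.
  + by apply/JI/JJ' => //; exact: lt_le_trans vu.
  move=> w vw wu; apply: le_trans (Hm _ vw wu) _.
  have Iw : I w by apply/JI/JJ'; [exact: lt_le_trans vw|exact: le_trans uu1].
  by apply: growth_ge_drift; [exact: sqU_gt0|exact: g_pos|exact: g_neg].
Qed.
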